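(* Let $\mathcal{E}$ be the ellipse $\frac{x^2}{a}+\frac{y^2}{b}=1$ ($a,b>0$) in the Minkowski plane, and let $n$ be an even positive integer. A light-like billiard trajectory within $\mathcal{E}$ is periodic with period $n$ if and only if $$\arctan\sqrt{\frac ab}\in\left\{\ \frac{k\pi}{n}\ \Big|\ 1\le k<\frac n2,\ \left(k,\frac n2\right)=1\ \right\},$$ where $k$ ranges over integers and $(\cdot,\cdot)$ denotes the greatest common divisor.
   Context: The Minkowski plane $\mathbf{E}^{1,1}$ is $\mathbf{R}^2$ with the scalar product $\langle (x,y),(x',y')\rangle=xx'-yy'$. A line is light-like if its direction vector $v\neq0$ satisfies $\langle v,v\rangle=0$, i.e. if it is parallel to $(1,1)$ or $(1,-1)$. Billiard reflection: given a line $\alpha$ (the tangent to the boundary at the reflection point) decompose a vector $v=u+n_\alpha$ with $u$ parallel to $\alpha$ and $n_\alpha$ orthogonal to $\alpha$ with respect to $\langle\cdot,\cdot\rangle$; the reflected vector is $v'=u-n_\alpha$. A billiard trajectory within $\mathcal{E}$ is a polygonal line with vertices on $\mathcal{E}$ whose consecutive segments are related by billiard reflection with respect to the tangent line of $\mathcal{E}$ at the common vertex. Reflection preserves the light-like type of a segment's line; a trajectory is light-like if its segments lie on light-like lines, and successive segments then have the two different light-like directions. At the points of $\mathcal{E}$ where the tangent line is light-like, a vector $v$ is by convention reflected into $-v$, and such a reflection is counted as two reflections. The period is the (least) number of reflections after which the trajectory closes. *)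

(* Defs.v *)
From Stdlib Require Import Reals List Arith.
Open Scope R_scope.

(* Stdlib real numbers; points and vectors of the Minkowski plane are pairs. *)

Definition vec : Type := (R * R)%type.

Definition vadd (v w : vec) : vec := (fst v + fst w, snd v + snd w).
Definition vsub (v w : vec) : vec := (fst v - fst w, snd v - snd w).
Definition vscale (c : R) (v : vec) : vec := (c * fst v, c * snd v).

Definition mdot (v w : vec) : R := fst v * fst w - snd v * snd w.

Definition lightlike (v : vec) : Prop := v <> (0, 0) /\ mdot v v = 0.

Definition on_ellipse (a b : R) (q : vec) : Prop :=
  fst q ^ 2 / a + snd q ^ 2 / b = 1.

(* Direction of the tangent line at the point [q] of the ellipse: a vector
   annihilated by the differential (2x/a, 2y/b) of x^2/a + y^2/b; it is
   nonzero whenever [q] is on the ellipse. *)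
Definition tangent_dir (a b : R) (q : vec) : vec := (- (snd q / b), fst q / a).

(* [v'] is the reflection of [v] off a line of direction [d]. If [d] is not
   light-like, the decomposition v = u + w exists and is unique; the light-like
   case is the convention v' = -v. *)
Definition reflects (d v v' : vec) : Prop :=
  (lightlike d /\ v' = vscale (-1) v) \/
  (~ lightlike d /\
   exists u w : vec,
     (exists c : R, u = vscale c d) /\ mdot w d = 0 /\
     v = vadd u w /\ v' = vsub u w).

Definition segment (p : nat -> vec) (i : nat) : vec := vsub (p (S i)) (p i).

(* Forward infinite polygonal line with vertices p 0, p 1, ... on the ellipse.
   The vector leaving a vertex is the reflection of the incoming one up to a
   positive factor, since only the direction of motion is prescribed. *)
Definition billiard_trajectory (a b : R) (p : nat -> vec) : Prop :=
  (forall i, on_ellipse a b (p i)) /\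
  (forall i, p (S i) <> p i) /\
  (forall i, exists (c : R) (v' : vec),
     0 < c /\ reflects (tangent_dir a b (p (S i))) (segment p i) v' /\
     segment p (S i) = vscale c v').

Definition lightlike_trajectory (a b : R) (p : nat -> vec) : Prop :=
  billiard_trajectory a b p /\ forall i, lightlike (segment p i).

(* Number of reflections counted at the boundary point [q]: two where the
   tangent line is light-like. The test is [lightlike] without its nonvanishing
   clause, which is automatic for tangent directions. *)
Definition reflection_count (a b : R) (q : vec) : nat :=
  if Req_EM_T (mdot (tangent_dir a b q) (tangent_dir a b q)) 0
  then 2%nat else 1%nat.

(* Number of reflections at the vertices p 1, ..., p N. *)
Definition reflections (a b : R) (p : nat -> vec) (N : nat) : nat :=
  list_sum (map (fun i => reflection_count a b (p i)) (seq 1 N)).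

(* Closing after [N] segments means that the whole motion repeats, so both the
   vertex and the direction of motion return; [m] is the number of reflections
   made meanwhile, which exceeds [N] if there are light-like tangents. *)
Definition closes_after (a b : R) (p : nat -> vec) (m : nat) : Prop :=
  exists N : nat,
    (0 < N)%nat /\ (forall i, p (i + N)%nat = p i) /\
    reflections a b p N = m.

Definition has_period (a b : R) (p : nat -> vec) (n : nat) : Prop :=
  closes_after a b p n /\ forall m, closes_after a b p m -> (n <= m)%nat.

(* Main.v *)
(** In the coordinates [(x / sqrt a, y / sqrt b)] the ellipse is the unit circle,
    and sending a point to the second end of the chord of light-like direction
    [(1, e)], [e = 1] or [-1], is a reflection of the circle. The two reflections
    compose to a rotation of angle [4 beta] up to sign, where
    [beta = atan (sqrt (a / b))]. A point with light-like tangent is fixed by one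
    of them; since it counts for two reflections, the trajectory is, up to
    repetition of such points, the orbit of its initial point under the
    alternating involutions, indexed by the number of reflections. Hence it closes
    after [m > 0] reflections iff [m] is even and [m * beta] is a multiple of
    [PI], and the least such [m] is read off [2 beta / PI] in lowest terms. *)

Require Import Defs.
From Stdlib Require Import Reals List Arith.
From Stdlib Require Import Lra Lia ZArith.
Open Scope R_scope.

(** * Light-like chords *)

(** The second intersection of the ellipse with the line through [q] of direction [(1, e)],
    simplified by [e * e = 1]; the result is linear in [q]. *)
Definition chord_end (a b e : R) (q : vec) : vec :=
  (((a - b) * fst q - 2 * e * a * snd q) / (a + b),
   ((b - a) * snd q - 2 * e * b * fst q) / (a + b)).

Lemma sqr_eq_1 (e : R) : e * e = 1 -> e = 1 \/ e = -1.
Proof.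
  intros H. assert (H0 : (e - 1) * (e + 1) = 0) by lra.
  apply Rmult_integral in H0. lra.
Qed.

Lemma lightlike_dir (v : vec) :
  lightlike v -> exists e t, e * e = 1 /\ t <> 0 /\ v = (t, t * e).
Proof.
  destruct v as [x y]. intros [Hn Hm]. unfold mdot in Hm; simpl in Hm.
  assert (Hx : x <> 0).
  { intros ->. apply Hn. f_equal. nra. }
  exists (y / x), x. split; [|split]; auto.
  - apply (Rmult_eq_reg_r (x * x)); [|nra]. field_simplify; lra.
  - f_equal. field; auto.
Qed.

Lemma on_ellipse_poly (a b : R) (q : vec) :
  0 < a -> 0 < b -> on_ellipse a b q ->
  b * (fst q * fst q) + a * (snd q * snd q) = a * b.
Proof.
  unfold on_ellipse. intros ha hb H.
  replace (a * b) with (a * b * (fst q ^ 2 / a + snd q ^ 2 / b))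
    by (rewrite H; ring).
  field. lra.
Qed.

Lemma on_ellipse_nonzero (a b : R) (q : vec) :
  0 < a -> 0 < b -> on_ellipse a b q -> fst q <> 0 \/ snd q <> 0.
Proof.
  intros ha hb H. apply on_ellipse_poly in H; auto.
  destruct (Req_dec (fst q) 0) as [E|E]; auto. right. intros E'.
  rewrite E, E' in H. nra.
Qed.

(** Along the line through [q], the ellipse equation is a quadratic in the parameter [t] with one
    root 0; a nonzero [t] must be the other root. *)
Lemma chord_end_unique (a b e t : R) (q q' : vec) :
  0 < a -> 0 < b -> e * e = 1 -> on_ellipse a b q -> on_ellipse a b q' ->
  t <> 0 -> vsub q' q = (t, t * e) -> q' = chord_end a b e q.
Proof.
  intros ha hb he Hq Hq' ht E.
  apply on_ellipse_poly in Hq; auto. apply on_ellipse_poly in Hq'; auto.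
  destruct q as [x y], q' as [x' y']. unfold vsub in E. simpl in *.
  injection E as E1 E2.
  assert (X : x' = x + t) by lra. assert (Y : y' = y + t * e) by lra.
  subst x' y'.
  assert (T : t * ((a + b) * t + 2 * (b * x + e * a * y)) = 0).
  { replace ((a + b) * t) with (b * t + a * t * (e * e)) by (rewrite he; ring).
    lra. }
  apply Rmult_integral in T. destruct T as [T|T]; [contradiction|].
  assert (T' : t = - 2 * (b * x + e * a * y) / (a + b)).
  { apply (Rmult_eq_reg_r (a + b)); [|lra]. field_simplify; lra. }
  unfold chord_end; simpl. rewrite T'. f_equal.
  - field. lra.
  - apply (Rmult_eq_reg_r (a + b)); [|lra]. field_simplify; try lra.
    replace (e ^ 2) with 1 by (simpl; lra). ring.
Qed.

(** The last hypothesis says that [(1, e)] is tangent at [q], so the chord degenerates. *)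
Lemma chord_end_fixed (a b e : R) (q : vec) :
  0 < a -> 0 < b -> e * e = 1 -> b * fst q + e * (a * snd q) = 0 ->
  chord_end a b e q = q.
Proof.
  intros ha hb he H. destruct q as [x y]; unfold chord_end; simpl in *.
  f_equal; apply (Rmult_eq_reg_r (a + b)); try lra; field_simplify; try lra.
  assert (e * (b * x + e * (a * y)) = 0) by (rewrite H; ring).
  replace (e * (b * x + e * (a * y))) with (e * b * x + e * e * (a * y)) in * by ring.
  rewrite he in *. lra.
Qed.

Lemma tangent_mdot (a b : R) (q : vec) :
  0 < a -> 0 < b -> mdot (tangent_dir a b q) (tangent_dir a b q) = 0 ->
  forall e, e * e = 1 ->
  b * fst q + e * (a * snd q) = 0 \/ b * fst q - e * (a * snd q) = 0.
Proof.
  intros ha hb H e he. apply Rmult_integral.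
  replace ((b * fst q + e * (a * snd q)) * (b * fst q - e * (a * snd q)))
    with (b * b * (fst q * fst q) - (e * e) * (a * a * (snd q * snd q))) by ring.
  rewrite he. unfold mdot, tangent_dir in H; simpl in H.
  replace (b * b * (fst q * fst q) - 1 * (a * a * (snd q * snd q)))
    with (- (a * a * (b * b)) *
      (- (snd q / b) * - (snd q / b) - fst q / a * (fst q / a)))
    by (field; lra).
  rewrite H. ring.
Qed.

(** If the slope were kept, the tangential part, half the sum of the two vectors, would be a
    multiple both of [(1, e)] and of the non-light-like [d], hence zero. The incoming vector would
    then be orthogonal to [d]; but only multiples of [(1, e)] are orthogonal to [(1, e)], so [d]
    would be light-like. *)
Lemma reflects_lightlike_flip (d : vec) (e e' s s' : R) :
  mdot d d <> 0 -> e * e = 1 -> e' * e' = 1 -> s <> 0 -> s' <> 0 ->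
  reflects d (s, s * e) (s', s' * e') -> e' = - e.
Proof.
  intros Hd he he' hs hs' [[[_ H] _]|[_ H]]; [contradiction|].
  destruct H as (u & w & [c ->] & Hw & E1 & E2).
  destruct (Req_dec e' e) as [->|Hne].
  2:{ destruct (sqr_eq_1 _ he), (sqr_eq_1 _ he'); lra. }
  exfalso. destruct d as [dx dy], w as [wx wy].
  unfold mdot, vadd, vsub, vscale in *; simpl in *.
  injection E1 as A1 A2. injection E2 as B1 B2.
  assert (K : c * (dx * dx - dy * dy) = 0).
  { assert (U1 : c * dx = (s + s') / 2) by lra.
    assert (U2 : c * dy = (s + s') / 2 * e) by lra.
    destruct (Req_dec c 0) as [->|Hc]; [ring|].
    apply (Rmult_eq_reg_l c); auto.
    replace (c * (c * (dx * dx - dy * dy)))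
      with ((c * dx) * (c * dx) - (c * dy) * (c * dy)) by ring.
    rewrite U1, U2.
    replace ((s + s') / 2 * ((s + s') / 2) -
             (s + s') / 2 * e * ((s + s') / 2 * e))
      with (((s + s') / 2) * ((s + s') / 2) * (1 - e * e)) by ring.
    rewrite he. ring. }
  apply Rmult_integral in K. destruct K as [->|K]; [|contradiction].
  assert (W1 : wx = s) by lra. assert (W2 : wy = s * e) by lra.
  subst wx wy.
  assert (D : s * (dx - e * dy) = 0) by lra.
  apply Rmult_integral in D. destruct D as [D|D]; [contradiction|].
  apply Hd. replace dx with (e * dy) by lra.
  replace (e * dy * (e * dy)) with ((e * e) * (dy * dy)) by ring.
  rewrite he; ring.
Qed.

(** * Alternating chords *)

(** In the coordinates [(x, t * y)] this is the rotation by [- alpha]. With [t = sqrt (a / b)] these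
    coordinates make the ellipse a circle. *)
Definition turn (t alpha : R) (q : vec) : vec :=
  (cos alpha * fst q + t * sin alpha * snd q,
   cos alpha * snd q - sin alpha * fst q / t).

Lemma turn_turn (t alpha alpha' : R) (q : vec) :
  t <> 0 -> turn t alpha (turn t alpha' q) = turn t (alpha + alpha') q.
Proof.
  intros ht. unfold turn; simpl. rewrite cos_plus, sin_plus.
  f_equal; field; auto.
Qed.

Lemma turn_fixed (t alpha : R) (q : vec) :
  t <> 0 -> fst q <> 0 \/ snd q <> 0 -> turn t alpha q = q -> cos alpha = 1.
Proof.
  destruct q as [x y]; unfold turn; simpl. intros ht Hq E.
  injection E as E1 E2.
  assert (E3 : t * (t * y * cos alpha) - t * sin alpha * x = t * t * y).
  { transitivity (t * t * (cos alpha * y - sin alpha * x / t)); [field; auto|].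
    rewrite E2; ring. }
  (* Pairing the fixed-point equations with [(x, t * y)] cancels the sine terms. *)
  assert (H : (cos alpha - 1) * (x * x + (t * y) * (t * y)) = 0).
  { assert (E4 : x * (cos alpha * x + t * sin alpha * y) = x * x) by (rewrite E1; ring).
    assert (E5 : y * (t * (t * y * cos alpha) - t * sin alpha * x) = y * (t * t * y))
      by (rewrite E3; ring).
    lra. }
  apply Rmult_integral in H. destruct H as [H|H]; [lra|exfalso].
  assert (X : x = 0) by nra. assert (Y : t * y = 0) by nra.
  apply Rmult_integral in Y. tauto.
Qed.

Definition slope_angle (a b : R) : R := atan (sqrt (a / b)).

Lemma cos_sin_double_atan (t : R) :
  cos (2 * atan t) = (1 - t * t) / (1 + t * t) /\
  sin (2 * atan t) = 2 * t / (1 + t * t).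
Proof.
  assert (P : 0 < 1 + t * t) by nra.
  assert (S : sqrt (1 + t²) * sqrt (1 + t²) = 1 + t * t).
  { rewrite sqrt_sqrt; unfold Rsqr; lra. }
  assert (S0 : sqrt (1 + t²) <> 0) by (intros H; rewrite H in S; lra).
  rewrite cos_2a, sin_2a, cos_atan, sin_atan.
  split; rewrite <- S; field; auto.
Qed.

Lemma chord_end_chord_end (a b e : R) (q : vec) :
  0 < a -> 0 < b -> e * e = 1 ->
  chord_end a b (- e) (chord_end a b e q) =
  turn (sqrt (a / b)) (e * (4 * slope_angle a b)) q.
Proof.
  intros ha hb he. unfold slope_angle.
  assert (Hab : 0 < a / b) by (apply Rdiv_lt_0_compat; auto).
  set (t := sqrt (a / b)).
  assert (Ht : 0 < t) by (apply sqrt_lt_R0; auto).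
  assert (Ht2 : t * t = a / b) by (apply sqrt_sqrt; lra).
  (* Eliminating [a] makes both sides rational in [t], once the angle is doubled twice. *)
  assert (Ha : a = t * t * b) by (rewrite Ht2; field; lra).
  clearbody t. clear Ht2 Hab. subst a.
  destruct (cos_sin_double_atan t) as [C S].
  assert (P : 0 < 1 + t * t) by nra.
  assert (C4 : cos (e * (4 * atan t)) =
    (1 - t*t)/(1+t*t) * ((1 - t*t)/(1+t*t)) - 2*t/(1+t*t) * (2*t/(1+t*t))
    /\ sin (e * (4 * atan t)) =
    e * (2 * (2*t/(1+t*t)) * ((1 - t*t)/(1+t*t)))).
  { rewrite <- C, <- S.
    destruct (sqr_eq_1 _ he) as [-> | ->].
    - replace (1 * (4 * atan t)) with (2 * (2 * atan t)) by ring.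
      rewrite cos_2a, (sin_2a (2 * atan t)). lra.
    - replace (-1 * (4 * atan t)) with (- (2 * (2 * atan t))) by ring.
      rewrite cos_neg, sin_neg, cos_2a, (sin_2a (2 * atan t)). lra. }
  destruct C4 as [C4 S4].
  unfold turn, chord_end; simpl. rewrite C4, S4.
  destruct (sqr_eq_1 _ he) as [-> | ->]; f_equal; field; split; nra.
Qed.

(** The index counts reflections rather than vertices, so the chord direction depends only on its
    parity. *)
Fixpoint chord_orbit (a b e : R) (q : vec) (m : nat) : vec :=
  match m with
  | O => q
  | S m => chord_end a b (e * (-1) ^ m) (chord_orbit a b e q m)
  end.

Lemma chord_orbit_even (a b e : R) (q : vec) (j : nat) :
  0 < a -> 0 < b -> e * e = 1 ->
  chord_orbit a b e q (2 * j) =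
  turn (sqrt (a / b)) (e * (INR (2 * j) * (2 * slope_angle a b))) q.
Proof.
  intros ha hb he.
  assert (Ht : 0 < sqrt (a / b)).
  { apply sqrt_lt_R0, Rdiv_lt_0_compat; auto. }
  induction j as [|j IH].
  - destruct q as [x y]. unfold turn. simpl. rewrite Rmult_0_l, Rmult_0_r, cos_0, sin_0.
    f_equal; field; lra.
  - replace (2 * S j)%nat with (S (S (2 * j))) by lia.
    cbn [chord_orbit]. rewrite <- tech_pow_Rmult, pow_1_even.
    replace (e * (-1 * 1)) with (- e) by ring. rewrite Rmult_1_r.
    rewrite IH, chord_end_chord_end, turn_turn; auto; try lra.
    f_equal. rewrite !S_INR. ring.
Qed.

Lemma chord_orbit_returns (a b e : R) (q : vec) (m : nat) :
  0 < a -> 0 < b -> e * e = 1 -> fst q <> 0 \/ snd q <> 0 -> Nat.Even m ->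
  chord_orbit a b e q m = q <->
  exists k : nat, INR m * slope_angle a b = INR k * PI.
Proof.
  intros ha hb he Hq [j ->].
  assert (Ht : 0 < sqrt (a / b)).
  { apply sqrt_lt_R0, Rdiv_lt_0_compat; auto. }
  assert (Hs : 0 < slope_angle a b).
  { unfold slope_angle. rewrite <- atan_0. apply atan_increasing; auto. }
  rewrite chord_orbit_even; auto.
  set (w := INR (2 * j) * slope_angle a b).
  assert (Hw : 0 <= w) by (apply Rmult_le_pos; [apply pos_INR|lra]).
  (* The turning angle is [e * (2 * w)]; the double-angle forms reduce the return to [sin w = 0]. *)
  assert (HC : cos (e * (INR (2 * j) * (2 * slope_angle a b)))
               = 1 - 2 * sin w * sin w).
  { rewrite <- cos_2a_sin. destruct (sqr_eq_1 _ he) as [-> | ->];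
    [|rewrite <- cos_neg]; f_equal; unfold w; ring. }
  assert (HS : sin (e * (INR (2 * j) * (2 * slope_angle a b)))
               = e * (2 * sin w * cos w)).
  { rewrite <- sin_2a. destruct (sqr_eq_1 _ he) as [-> | ->].
    - rewrite !Rmult_1_l. f_equal. unfold w; ring.
    - replace (-1 * sin (2 * w)) with (- sin (2 * w)) by ring.
      rewrite <- sin_neg. f_equal. unfold w; ring. }
  split.
  - intros H. apply turn_fixed in H; auto; [|lra].
    rewrite HC in H. assert (S0 : sin w = 0) by nra.
    destruct (sin_eq_0_0 _ S0) as [k Hk].
    assert (0 <= k)%Z.
    { apply le_IZR. pose proof PI_RGT_0. nra. }
    exists (Z.to_nat k). rewrite INR_IZR_INZ, Z2Nat.id; auto.
  - intros [k Hk].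
    assert (S0 : sin w = 0).
    { rewrite Hk. apply sin_eq_0_1. exists (Z.of_nat k).
      rewrite <- INR_IZR_INZ. auto. }
    destruct q as [x y]. unfold turn. rewrite HC, HS, S0. simpl.
    f_equal; field; lra.
Qed.

(** * The trajectory as a chord orbit *)

Lemma reflections_S (a b : R) (p : nat -> vec) (N : nat) :
  reflections a b p (S N) =
  (reflections a b p N + reflection_count a b (p (S N)))%nat.
Proof.
  unfold reflections. rewrite seq_S, map_app, list_sum_app. simpl. lia.
Qed.

Lemma reflection_count_cases (a b : R) (q : vec) :
  (reflection_count a b q = 1%nat /\
   mdot (tangent_dir a b q) (tangent_dir a b q) <> 0) \/
  (reflection_count a b q = 2%nat /\
   mdot (tangent_dir a b q) (tangent_dir a b q) = 0).
Proof. unfold reflection_count. destruct Req_EM_T; auto. Qed.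

(** The count grows by one or two per vertex, so a value [m] can be missed only in the middle of a
    double reflection. *)
Lemma reflections_skip (a b : R) (p : nat -> vec) (m : nat) :
  (exists N, reflections a b p N = m) \/
  (exists N, S (reflections a b p N) = m /\
     mdot (tangent_dir a b (p (S N))) (tangent_dir a b (p (S N))) = 0).
Proof.
  induction m as [|m [[N IH]|[N [IH IH']]]].
  - left. exists O. reflexivity.
  - destruct (reflection_count_cases a b (p (S N))) as [[H _]|[H H']].
    + left. exists (S N). rewrite reflections_S. lia.
    + right. exists N. split; auto.
  - left. exists (S N). rewrite reflections_S.
    destruct (reflection_count_cases a b (p (S N))) as [[_ H]|[H _]];
      [contradiction|lia].
Qed.

Lemma sign_sqr (e : R) (m : nat) :
  e * e = 1 -> e * (-1) ^ m * (e * (-1) ^ m) = 1.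
Proof.
  intros he.
  replace (e * (-1) ^ m * (e * (-1) ^ m)) with (e * e * ((-1) ^ m * (-1) ^ m)) by ring.
  rewrite he, <- Rpow_mult_distr. replace (-1 * -1) with 1 by ring.
  rewrite pow1. ring.
Qed.

Lemma sign_even (e : R) (m : nat) :
  e * e = 1 -> e * (-1) ^ m = e -> Nat.Even m.
Proof.
  intros he H. destruct (Nat.Even_or_Odd m) as [|[j Hj]]; auto.
  exfalso. rewrite Hj, Nat.add_1_r, pow_1_odd in H.
  assert (e = 0) by lra. subst e. lra.
Qed.

(** The invariant of the motion: the number of reflections made so far determines both the position
    and the slope of the next segment. *)
Definition on_orbit (a b e : R) (p : nat -> vec) (i : nat) : Prop :=
  p i = chord_orbit a b e (p O) (reflections a b p i) /\
  exists t, t <> 0 /\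
    segment p i = (t, t * (e * (-1) ^ reflections a b p i)).

Lemma on_orbit_next (a b e : R) (p : nat -> vec) (i : nat) :
  0 < a -> 0 < b -> e * e = 1 -> billiard_trajectory a b p -> on_orbit a b e p i ->
  p (S i) = chord_orbit a b e (p O) (S (reflections a b p i)).
Proof.
  intros ha hb he [Hon _] [Hp (t & ht & Hs)].
  cbn [chord_orbit]. rewrite <- Hp.
  apply chord_end_unique with t; auto. apply sign_sqr; auto.
Qed.

(* The light-like tangent at [p (S i)] cannot have the direction of the chord
   arriving there, which meets the ellipse in two points. *)
Lemma on_orbit_tangent (a b e : R) (p : nat -> vec) (i : nat) :
  0 < a -> 0 < b -> e * e = 1 -> billiard_trajectory a b p -> on_orbit a b e p i ->
  mdot (tangent_dir a b (p (S i))) (tangent_dir a b (p (S i))) = 0 ->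
  p (S i) = chord_orbit a b e (p O) (S (S (reflections a b p i))).
Proof.
  intros ha hb he Hb Ho Ht.
  pose proof (on_orbit_next _ _ _ _ _ ha hb he Hb Ho) as Hn.
  destruct Hb as [Hon [Hne _]]. destruct Ho as [Hp (t & ht & Hs)].
  set (r := reflections a b p i) in *.
  change (chord_orbit a b e (p O) (S (S r))) with
    (chord_end a b (e * (-1) ^ S r) (chord_orbit a b e (p O) (S r))).
  rewrite <- Hn. rewrite <- tech_pow_Rmult.
  replace (e * (-1 * (-1) ^ r)) with (- (e * (-1) ^ r)) by ring.
  assert (hs : e * (-1) ^ r * (e * (-1) ^ r) = 1) by (apply sign_sqr; auto).
  set (s := e * (-1) ^ r) in *.
  symmetry. destruct (tangent_mdot _ _ _ ha hb Ht s hs) as [H|H].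
  - exfalso. apply (Hne i).
    assert (E : p i = chord_end a b s (p (S i))).
    { apply chord_end_unique with (- t); auto; [lra|].
      unfold segment, vsub in *. destruct (p i), (p (S i)); simpl in *.
      injection Hs as H1 H2. f_equal; lra. }
    rewrite chord_end_fixed in E; auto.
  (* Here the tangent has the direction of the next chord, so this chord shrinks to the point. *)
  - apply chord_end_fixed; auto; lra.
Qed.

(** At an ordinary vertex the slope changes sign and the count rises by one. At a light-like tangent
    the vector is reversed, which keeps the slope, and the count rises by two; so slope and parity
    stay in step. *)
Lemma on_orbit_all (a b e t : R) (p : nat -> vec) :
  0 < a -> 0 < b -> e * e = 1 -> lightlike_trajectory a b p ->
  t <> 0 -> segment p O = (t, t * e) -> forall i, on_orbit a b e p i.
Proof.
  intros ha hb he [Hb Hl] ht Hs i. induction i as [|i IH].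
  - split; [reflexivity|]. exists t. split; auto.
    rewrite Hs. simpl. f_equal; ring.
  - pose proof (on_orbit_next _ _ _ _ _ ha hb he Hb IH) as Hn.
    pose proof (on_orbit_tangent _ _ _ _ _ ha hb he Hb IH) as Hn2.
    unfold on_orbit. rewrite reflections_S.
    destruct Hb as [Hon [Hne Hr]]. destruct IH as [Hp (s & hs & HS)].
    destruct (Hr i) as (c & v' & Hc & Hrefl & Hseg).
    destruct (lightlike_dir _ (Hl (S i))) as (e' & s' & he' & hs' & HS').
    assert (Hv : v' = (s' / c, s' / c * e')).
    { rewrite HS' in Hseg. destruct v' as [v1 v2]. unfold vscale in Hseg; simpl in Hseg.
      injection Hseg as E1 E2. f_equal.
      - rewrite E1. field; lra.
      - apply (Rmult_eq_reg_l c); [|lra]. rewrite <- E2. field; lra. }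
    assert (hv : s' / c <> 0).
    { apply Rmult_integral_contrapositive_currified; auto.
      apply Rinv_neq_0_compat; lra. }
    set (r := reflections a b p i) in *.
    destruct (reflection_count_cases a b (p (S i))) as [[K K']|[K K']]; rewrite K.
    + rewrite Nat.add_1_r. split; auto. exists s'. split; auto.
      rewrite HS'. rewrite HS, Hv in Hrefl.
      apply reflects_lightlike_flip in Hrefl; auto; [|apply sign_sqr; auto].
      rewrite Hrefl. f_equal. simpl. ring.
    + replace (r + 2)%nat with (S (S r)) by lia. split; auto.
      destruct Hrefl as [[_ E]|[H _]].
      (* A tangent direction is nonzero on the ellipse, so its vanishing square makes it
         light-like. *)
      2:{ exfalso. apply H. split; auto. unfold tangent_dir. intros E.
          injection E as E1 E2.
          destruct (on_ellipse_nonzero _ _ _ ha hb (Hon (S i))) as [Q|Q]; apply Q.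
          - replace (fst (p (S i))) with (a * (fst (p (S i)) / a)) by (field; lra).
            rewrite E2; ring.
          - replace (snd (p (S i))) with (- b * (- (snd (p (S i)) / b))) by (field; lra).
            rewrite E1; ring. }
      rewrite Hseg, E, HS. unfold vscale. exists (- (c * s)). split.
      * assert (c * s <> 0) by (apply Rmult_integral_contrapositive_currified; lra).
        lra.
      * simpl. f_equal; ring.
Qed.

Lemma closes_after_iff (a b : R) (p : nat -> vec) (m : nat) :
  0 < a -> 0 < b -> lightlike_trajectory a b p ->
  closes_after a b p m <->
  (0 < m)%nat /\ Nat.Even m /\
  exists k : nat, INR m * slope_angle a b = INR k * PI.
Proof.
  intros ha hb Hp. pose proof Hp as [Hb Hl].
  destruct (lightlike_dir _ (Hl O)) as (e & t & he & ht & Hs).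
  pose proof (on_orbit_all _ _ _ _ _ ha hb he Hp ht Hs) as Ho.
  assert (Hq : fst (p O) <> 0 \/ snd (p O) <> 0).
  { apply on_ellipse_nonzero with a b; auto. apply Hb. }
  assert (Hstep : forall i, p (S i) =
            chord_end a b (e * (-1) ^ reflections a b p i) (p i)).
  { intros i. rewrite (on_orbit_next _ _ _ _ _ ha hb he Hb (Ho i)).
    cbn [chord_orbit]. destruct (Ho i) as [<- _]. reflexivity. }
  split.
  - intros (N & HN & Hper & Hm). subst m.
    assert (Hpos : (0 < reflections a b p N)%nat).
    { destruct N as [|N]; [lia|]. rewrite reflections_S.
      destruct (reflection_count_cases a b (p (S N))) as [[-> _]|[-> _]]; lia. }
    (* The first segment recurs after [N] steps, so its slope does too, and this forces an even
       count. *)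
    destruct (Ho N) as [HpN (s & hs & HsN)].
    assert (Hev : Nat.Even (reflections a b p N)).
    { apply sign_even with e; auto. unfold segment in HsN, Hs.
      rewrite (Hper 1%nat : p (S N) = p 1%nat), (Hper O : p N = p O), Hs in HsN.
      injection HsN as H1 H2. subst s. apply (Rmult_eq_reg_l t); auto. }
    split; [|split]; auto.
    apply (chord_orbit_returns a b e (p O)); auto.
    rewrite <- HpN. apply (Hper O).
  - intros (Hpos & Hev & Hk).
    apply (chord_orbit_returns a b e (p O)) in Hk; auto.
    assert (Hsgn : (-1) ^ m = 1) by (destruct Hev as [j ->]; apply pow_1_even).
    destruct (reflections_skip a b p m) as [[N HN]|[N [HN Ht]]].
    + exists N. split; [|split]; auto.
      * destruct N; [unfold reflections in HN; simpl in HN|]; lia.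
      (* The count is carried along because its parity selects the next chord; the shift by the even
         [m] preserves it. *)
      * assert (H : forall i, p (i + N)%nat = p i /\
          reflections a b p (i + N) = (reflections a b p i + m)%nat).
        { induction i as [|i [IH1 IH2]].
          - destruct (Ho N) as [HpN _]. rewrite HN in HpN.
            split; [simpl; congruence|exact HN].
          - assert (E : p (S i + N)%nat = p (S i)).
            { simpl. rewrite (Hstep (i + N)%nat), (Hstep i), IH1, IH2.
              rewrite pow_add, Hsgn, Rmult_1_r. reflexivity. }
            split; auto. simpl. simpl in E. rewrite !reflections_S, E, IH2. lia. }
        intros i. apply H.
    + (* The orbit would stay at [p 0] for one step, but [p 1 <> p 0]. *)
      exfalso. destruct Hb as [Hon [Hne Hr]]. apply (Hne O).
      pose proof (on_orbit_next _ _ _ _ _ ha hb he (proj1 Hp) (Ho N)) as H1.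
      pose proof (on_orbit_tangent _ _ _ _ _ ha hb he (proj1 Hp) (Ho N) Ht) as H2.
      rewrite HN in H1, H2. cbn [chord_orbit] in H2.
      rewrite Hk in H1, H2. rewrite Hsgn in H2.
      rewrite (Hstep O). simpl. congruence.
Qed.

(** * The least period *)

Theorem theorem3p3 (a b : R) (ha : 0 < a) (hb : 0 < b)
  (n : nat) (hn : (0 < n)%nat) (hev : Nat.Even n)
  (p : nat -> vec) (hp : lightlike_trajectory a b p) :
  has_period a b p n <->
  exists k : nat,
    (1 <= k < n / 2)%nat /\ Nat.gcd k (n / 2) = 1%nat /\
    atan (sqrt (a / b)) = INR k * PI / INR n.
Proof.
  unfold has_period. rewrite closes_after_iff; auto.
  fold (slope_angle a b). set (w := slope_angle a b) in *.
  assert (Hw : 0 < w < PI / 2).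
  { unfold w, slope_angle. split; [|apply atan_bound].
    rewrite <- atan_0. apply atan_increasing, sqrt_lt_R0, Rdiv_lt_0_compat; auto. }
  pose proof PI_RGT_0 as HPI.
  destruct hev as [h ->].
  replace (2 * h / 2)%nat with h by (rewrite Nat.mul_comm, Nat.div_mul; lia).
  assert (Hh : 0 < INR h) by (apply lt_0_INR; lia).
  assert (H2h : INR (2 * h) = 2 * INR h) by (rewrite mult_INR; simpl; ring).
  split.
  - intros [(_ & _ & k & Hk) Hmin]. exists k. rewrite H2h in Hk.
    split; [split|split].
    (* The bounds on [k] come from [0 < w < PI / 2]. *)
    + destruct k; [simpl in Hk; nra|lia].
    + apply INR_lt. apply (Rmult_lt_reg_r PI); auto. nra.
    (* Dividing [k] and [h] by their gcd [g] gives a closing after [2 * h'] reflections; minimality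
       forces [g = 1]. *)
    + destruct (Nat.gcd_divide k h) as [[k' Hk'] [h' Hh']].
      set (g := Nat.gcd k h) in *.
      assert (Hh'0 : (0 < h')%nat) by (destruct h'; lia).
      assert (Hg : (0 < g)%nat) by (destruct g; lia).
      assert (Hle : (2 * h <= 2 * h')%nat).
      { apply Hmin. apply closes_after_iff; auto.
        split; [lia|split; [exists h'; auto|]]. exists k'. fold w.
        apply (Rmult_eq_reg_r (INR g)); [|apply not_0_INR; lia].
        rewrite Hk', Hh', !mult_INR in Hk. rewrite mult_INR. simpl INR at 1. lra. }
      nia.
    + rewrite H2h. apply (Rmult_eq_reg_r (2 * INR h)); [|lra].
      rewrite Rmult_comm, Hk. field. lra.
  - intros (k & [Hk1 Hk2] & Hgcd & E). split.
    + split; [lia|split; [exists h; auto|]]. exists k. rewrite E, H2h. field. lra.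
    + intros m Hm. apply closes_after_iff in Hm; auto. fold w in Hm.
      destruct Hm as (Hm & [j ->] & l & Hl).
      (* Comparing the two expressions for [w] gives an integer identity; as [k] and [h] are
         coprime, [h] divides [j]. *)
      assert (Hcross : (h * l = k * j)%nat).
      { apply INR_eq. rewrite !mult_INR. rewrite E, H2h, mult_INR in Hl.
        apply (Rmult_eq_reg_r PI); [|lra].
        replace (INR h * INR l * PI) with (INR h * (INR l * PI)) by ring.
        rewrite <- Hl. simpl INR at 2. field. lra. }
      assert (D : Nat.divide h j).
      { apply Nat.gauss with k; [exists l; lia|].
        rewrite Nat.gcd_comm; auto. }
      apply Nat.divide_pos_le in D; lia.
Qed.
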